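(* For every non-empty zero-dimensional space $X$ there exists a non-empty zero-dimensional space $Y$ such that $X\times Y$ is h-homogeneous. Furthermore, if $X$ is compact, then $Y$ can be chosen to be compact.
   Context: All spaces are assumed to be Tychonoff. A subset of a space is clopen if it is closed and open. A space is zero-dimensional if it has a base consisting of clopen sets. A space is h-homogeneous if all of its non-empty clopen subsets (with the subspace topology) are homeomorphic to each other. *)

(* Defs.v *)
From HB Require Import structures.
From mathcomp Require Import all_boot.
From mathcomp Require Import all_classical all_reals all_analysis.

Set Implicit Arguments.
Unset Strict Implicit.
Unset Printing Implicit Defensive.

Local Open Scope classical_set_scope.

(* The library's [completely_regular_space] does not include T1. It separates
   points from closed sets by a coarser uniformity; [uniform_separatorP] turns
   this into separation by a continuous [0, 1]-valued function. *)
Definition tychonoff_space (T : topologicalType) : Prop :=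
  accessible_space T /\ completely_regular_space T.

(* Not the library's [zero_dimensional], which only asks that distinct points
   be separated by a clopen set and is weaker in general. *)
Definition zero_dimensional_space (T : topologicalType) : Prop :=
  exists2 B : set (set T), basis B & B `<=` clopen.

Definition homeomorphic (S T : topologicalType) : Prop :=
  exists (f : S -> T) (g : T -> S),
    [/\ cancel f g, cancel g f, continuous f & continuous g].

(* [U] and [V], coerced to types by [set_type], carry the subspace topology
   (the initial topology for the inclusion). *)
Definition h_homogeneous (T : topologicalType) : Prop :=
  forall U V : set T, clopen U -> U !=set0 -> clopen V -> V !=set0 ->
  homeomorphic U V.

(* Main.v *)
Require Import Defs.
From HB Require Import structures.
From mathcomp Require Import all_boot.
From mathcomp Require Import all_classical all_reals all_analysis.

Set Implicit Arguments.
Unset Strict Implicit.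
Unset Printing Implicit Defensive.

Local Open Scope classical_set_scope.

(* For a zero-dimensional space X' let Z be the product of all nonempty clopen
   subsets of X', each repeated countably often. A nonempty box in Z is again a
   product of nonempty clopen subsets of X' in which each of them occurs
   countably often, so it is homeomorphic to Z; and Z absorbs as a factor any
   space homeomorphic to a nonempty clopen subset of X'. Take X' = X * K with K
   discrete: then X * Z and K * Z are homeomorphic to Z, and Y := Z works.
   For K = nat, Z is a countable sum of copies of itself, and Pelczynski's
   decomposition method turns a box inside a clopen set C into a homeomorphism
   of C with Z. For X compact and K = bool, Z is compact and homeomorphic to
   Z + Z, and each clopen set is a finite disjoint union of boxes. *)

(** * Clopen neighbourhoods and complete regularity *)

Lemma zero_dimensional_spaceP (T : topologicalType) :
  zero_dimensional_space T <->
  forall (x : T) N, nbhs x N -> exists C, [/\ clopen C, C x & C `<=` N].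
Proof.
split=> [[B [_ Bnbhs] Bcl] x N /Bnbhs [C [BC Cx] CN]|h].
  by exists C; split => //; exact: Bcl.
exists clopen => //; split=> [C []//|x N /h [C [cC Cx CN]]].
by exists C.
Qed.

Lemma eq_on_open_continuous (S T : topologicalType) (f g : S -> T)
    (A : set S) x :
  open A -> A x -> (forall y, A y -> f y = g y) ->
  {for x, continuous g} -> {for x, continuous f}.
Proof.
move=> oA Ax fg cg; rewrite /prop_for /continuous_at (fg _ Ax).
apply: cvg_trans cg; apply: near_eq_cvg.
near=> y; apply: esym; apply: fg; near: y.
exact: open_nbhs_nbhs.
Unshelve. all: by end_near. Qed.

Lemma zero_dimensional_completely_regular (T : topologicalType) :
  zero_dimensional_space T -> completely_regular_space T.
Proof.
move=> /zero_dimensional_spaceP zT a B cB nBa.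
have [|C [[oC cC] Ca CB]] := zT a (~` B).
  by apply: open_nbhs_nbhs; split => //; exact: closed_openC.
pose f (x : T) : bool := `[< C x >].
have cf : continuous f.
  move=> x; have [Cx|nCx] := pselect (C x).
    apply: (eq_on_open_continuous (g := cst true) oC) => //.
      by move=> y Cy; apply/asboolP.
    exact: cst_continuous.
  apply: (eq_on_open_continuous (g := cst false) (A := ~` C)) => //.
  - exact: closed_openC.
  - by move=> y Cy; apply/asboolP.
  - exact: cst_continuous.
(* Pulling the uniformity of [bool] back along the indicator of [C] gives a coarser uniformity, in
   which the pairs with equal indicator form an entourage separating [a] from [B]. *)
pose T' : uniformType := initial_topology f.
exists (Uniform.class T'), ([set xy | f xy.1 = f xy.2]); split.
- exists [set xy | xy.1 = xy.2] => //.
  by move=> _ [b _ <-].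
- rewrite -subset0 => -[x y [[/= -> By]]] fxy.
  suff /asboolP Cy : f y by exact: (CB _ Cy).
  by rewrite -fxy; apply/asboolP.
- move=> x U [V [[W oW <- /=]]] ? /filterS; apply.
  by apply: cf; exact: open_nbhs_nbhs.
Qed.

(* Total maps avoid the subtypes [A] and [B]. Continuity at the points of [A] in
   the ambient space is the same as continuity on the subspace when [A] is
   open, the only case of interest. *)
Definition piece_homeomorphic (S T : topologicalType) (A : set S) (B : set T) :=
  exists (f : S -> T) (g : T -> S),
  [/\ forall x, A x -> [/\ B (f x), g (f x) = x & {for x, continuous f}]
    & forall y, B y -> [/\ A (g y), f (g y) = y & {for y, continuous g}]].

Lemma set_val_continuous (T : topologicalType) (A : set T) :
  continuous (set_val : A -> T).
Proof. exact: initial_continuous. Qed.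

Lemma piece_homeomorphic_subtype (T : topologicalType) (A B : set T) :
  piece_homeomorphic A B -> homeomorphic A B.
Proof.
move=> [f [g [fA gB]]].
have fP (a : A) : f (set_val a) \in B.
  by apply/mem_set; case: (fA _ (set_mem (valP a))).
have gP (b : B) : g (set_val b) \in A.
  by apply/mem_set; case: (gB _ (set_mem (valP b))).
exists (fun a : A => SigSub (fP a) : B), (fun b : B => SigSub (gP b) : A).
split.
- by move=> a; apply: val_inj => /=; case: (fA _ (set_mem (valP a))).
- by move=> b; apply: val_inj => /=; case: (gB _ (set_mem (valP b))).
- apply: continuous_comp_initial => a.
  apply: (@continuous_comp A T T set_val f).
    exact: set_val_continuous.
  by case: (fA _ (set_mem (valP a))).
- apply: continuous_comp_initial => b.
  apply: (@continuous_comp B T T set_val g).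
    exact: set_val_continuous.
  by case: (gB _ (set_mem (valP b))).
Qed.

Lemma homeomorphic_piece (S T : topologicalType) :
  homeomorphic S T <-> piece_homeomorphic [set: S] [set: T].
Proof.
split=> [[f [g [fK gK cf cg]]]|[f [g [fS gT]]]]; exists f, g.
  by split=> x _; split => //; [exact: cf|exact: cg].
by split=> x; [case: (fS x I)|case: (gT x I)|case: (fS x I)|case: (gT x I)].
Qed.

(** * Composing, restricting and gluing homeomorphisms between pieces *)

Lemma piece_homeomorphic_sym (S T : topologicalType) (A : set S) (B : set T) :
  piece_homeomorphic A B -> piece_homeomorphic B A.
Proof. by move=> [f [g [fA gB]]]; exists g, f. Qed.

Lemma piece_homeomorphic_trans (S T U : topologicalType) (A : set S)
    (B : set T) (C : set U) :
  piece_homeomorphic A B -> piece_homeomorphic B C -> piece_homeomorphic A C.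
Proof.
move=> [f [g [fA gB]]] [f' [g' [fB gC]]].
exists (f' \o f), (g \o g'); split=> x.
  move=> /fA [/fB [Cx f'K cf'] fK cf].
  by split=> //=; [rewrite f'K|exact: continuous_comp].
move=> /gC [/gB [Cx f'K cf'] fK cf].
by split=> //=; [rewrite f'K|exact: continuous_comp].
Qed.

(** The maps are explicit arguments because the image of [A'] is described through [g]. *)
Lemma piece_homeomorphic_restrict (S T : topologicalType) (A : set S)
    (B : set T) (f : S -> T) (g : T -> S) (A' : set S) :
  (forall x, A x -> [/\ B (f x), g (f x) = x & {for x, continuous f}]) ->
  (forall y, B y -> [/\ A (g y), f (g y) = y & {for y, continuous g}]) ->
  piece_homeomorphic (A `&` A') (B `&` g @^-1` A').
Proof.
move=> fA gB; exists f, g; split=> [x [Ax A'x]|y [By A'y]].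
  by have [Bx fK cf] := fA _ Ax; split=> //; split=> //=; rewrite fK.
by have [Ay gK cg] := gB _ By.
Qed.

(** [g] may be discontinuous outside [B], where the bare preimage could fail to be open. *)
Lemma open_setI_preimage (S T : topologicalType) (B : set T) (g : T -> S)
    (U : set S) :
  open B -> (forall y, B y -> {for y, continuous g}) -> open U ->
  open (B `&` g @^-1` U).
Proof.
move=> oB cg oU; rewrite openE => y [By Uy]; apply: filterI.
  exact: open_nbhs_nbhs.
by apply: cg => //; exact: open_nbhs_nbhs.
Qed.

Lemma clopen_setI_preimage (S T : topologicalType) (B : set T) (g : T -> S)
    (U : set S) :
  clopen B -> (forall y, B y -> {for y, continuous g}) -> clopen U ->
  clopen (B `&` g @^-1` U).
Proof.
move=> [oB cB] cg [oU cU]; split; first exact: open_setI_preimage.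
(* A point of the complement lies outside [B], or in [B] with its image outside [U]; both conditions
   are open. *)
rewrite -openC (_ : ~` _ = ~` B `|` B `&` g @^-1` (~` U)).
  apply: openU; first exact: closed_openC.
  by apply: open_setI_preimage => //; exact: closed_openC.
apply/seteqP; split=> y /=; have [By|nBy] := pselect (B y).
- by move=> nBU; right; split=> // Uy; exact: nBU.
- by left.
- by case=> [//|[_ nU] [_ /nU]].
- by move=> _ [].
Qed.

(** Near a point of an open piece the glued map coincides with the map of that piece; disjointness
    makes the choice of piece unambiguous. *)
Lemma piece_homeomorphic_setU (S T : topologicalType) (A1 A2 : set S)
    (B1 B2 : set T) :
  open A1 -> open A2 -> open B1 -> open B2 ->
  A1 `&` A2 = set0 -> B1 `&` B2 = set0 ->
  piece_homeomorphic A1 B1 -> piece_homeomorphic A2 B2 ->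
  piece_homeomorphic (A1 `|` A2) (B1 `|` B2).
Proof.
(* Stated for arbitrary spaces, so that it serves the glued map and, with the roles exchanged, its
   inverse. *)
have glue (S' T' : topologicalType) (C1 C2 : set S') (D1 D2 : set T')
    (f1 f2 : S' -> T') (g1 g2 : T' -> S') :
    open C1 -> open C2 -> C1 `&` C2 = set0 -> D1 `&` D2 = set0 ->
    (forall x, C1 x ->
      [/\ D1 (f1 x), g1 (f1 x) = x & {for x, continuous f1}]) ->
    (forall x, C2 x ->
      [/\ D2 (f2 x), g2 (f2 x) = x & {for x, continuous f2}]) ->
    let f x := if `[< C1 x >] then f1 x else f2 x in
    let g y := if `[< D1 y >] then g1 y else g2 y in
    forall x, (C1 `|` C2) x ->
    [/\ (D1 `|` D2) (f x), g (f x) = x & {for x, continuous f}].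
  move=> oC1 oC2 C12 D12 h1 h2 f g.
  have fC1 x : C1 x -> f x = f1 x by rewrite /f; case: asboolP.
  have fC2 x : C2 x -> f x = f2 x.
    rewrite /f; case: asboolP => // C1x C2x.
    by have : (C1 `&` C2) x by []; rewrite C12.
  have gD1 y : D1 y -> g y = g1 y by rewrite /g; case: asboolP.
  have gD2 y : D2 y -> g y = g2 y.
    rewrite /g; case: asboolP => // D1y D2y.
    by have : (D1 `&` D2) y by []; rewrite D12.
  move=> x [Cx|Cx].
    have [Dx gK cf] := h1 _ Cx; rewrite fC1// gD1//.
    by split=> //; [left|exact: (eq_on_open_continuous oC1 Cx fC1)].
  have [Dx gK cf] := h2 _ Cx; rewrite fC2// gD2//.
  by split=> //; [right|exact: (eq_on_open_continuous oC2 Cx fC2)].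
move=> oA1 oA2 oB1 oB2 A12 B12 [f1 [g1 [fA1 gB1]]] [f2 [g2 [fA2 gB2]]].
exists (fun x => if `[< A1 x >] then f1 x else f2 x),
  (fun y => if `[< B1 y >] then g1 y else g2 y).
by split=> x; [exact: glue|exact: glue].
Qed.

(** Clopen sets need not be compared with each other: it is enough to compare each nonempty one with
    the whole of [T]. *)
Lemma homeomorphic_h_homogeneous (S T : topologicalType) :
  homeomorphic S T ->
  (forall C : set T, clopen C -> C !=set0 -> piece_homeomorphic C [set: T]) ->
  h_homogeneous S.
Proof.
move=> [f [g [fK gK cf cg]]] hT.
have hS (U : set S) : clopen U -> U !=set0 -> piece_homeomorphic U [set: T].
  move=> cU [u Uu]; apply: (@piece_homeomorphic_trans _ T _ _ (g @^-1` U)).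
    exists f, g; split=> [x Ux|y Uy]; split=> //=.
    - by rewrite fK.
    - exact: cf.
    - exact: cg.
  apply: hT; first exact: preimage_clopen.
  by exists (f u); rewrite /= fK.
move=> U V cU U0 cV V0; apply: piece_homeomorphic_subtype.
apply: piece_homeomorphic_trans (hS _ cU U0) _.
exact/piece_homeomorphic_sym/hS.
Qed.

Lemma piece_homeomorphic_slice (D : discreteTopologicalType)
    (T : topologicalType) (k : D) (C : set T) :
  piece_homeomorphic ([set k] `*` C) C.
Proof.
exists snd, (pair k); split=> [[a x] [/= -> Cx]|x Cx]; split=> //.
- exact: cvg_snd.
- by apply: cvg_pair => //; exact: cvg_cst.
Qed.

(* [r] shifts the row of [d] up by one to make room for [j0], and closes the gap
   this leaves in the row of [j0]. *)
Lemma exists_move_to_row (W : eqType) (j0 : nat * W) (d : W) :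
  exists r r' : nat * W -> nat * W, [/\ cancel r r', cancel r' r,
    (r j0).2 = d & forall j, j != j0 -> (r j).2 = j.2].
Proof.
have [<-|/negPf dj0] := eqVneq j0.2 d; first by exists id, id.
exists (fun j => if j == j0 then (0, d) else if j.2 == d then (j.1.+1, d)
         else if j.2 == j0.2 then (unbump j0.1 j.1, j0.2) else j),
  (fun j => if j.2 == d then if j.1 is n.+1 then (n, d) else j0
         else if j.2 == j0.2 then (bump j0.1 j.1, j0.2) else j).
case: j0 dj0 => n w /= wd; split.
- move=> [m v]; have [-> //=|] := eqVneq (m, v) (n, w); first by rewrite eqxx.
  rewrite xpair_eqE /=; have [->|/negPf vd] := eqVneq v d.
    by rewrite /= eqxx.
  have [->|/negPf vw] := eqVneq v w; last by rewrite /= vd vw.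
  by rewrite andbT /= wd eqxx => mn; rewrite unbumpK// inE.
- move=> [m v] /=; have [->|/negPf vd] := eqVneq v d.
    case: m => [|m] /=; first by rewrite eqxx.
    by rewrite xpair_eqE [d == w]eq_sym wd andbF eqxx.
  have [->|/negPf vw] := eqVneq v w; last by rewrite xpair_eqE /= vd vw andbF.
  by rewrite xpair_eqE /= eqxx wd andbT eq_sym (negPf (neq_bump _ _)) bumpK.
- by rewrite eqxx.
- move=> [m v] /negPf -> /=; case: eqVneq => [->//|_].
  by case: eqVneq => [->|].
Qed.

(** * The product Z of the nonempty clopen subsets, each repeated countably often *)

Section clopen_product.
Context (X : topologicalType).

Definition clopen_part := set_type [set U : set X | clopen U /\ U !=set0].

(** A subspace of a power of [X] rather than a dependent product: all coordinates live in one space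
    and can be moved freely between indices. *)
Definition clopen_product := set_type
  [set z : {ptws (nat * clopen_part) -> X} | forall i, set_val i.2 (z i)].

Implicit Types (i : nat * clopen_part) (z : clopen_product) (U : clopen_part).

Lemma clopen_partP U : clopen (set_val U) /\ set_val U !=set0.
Proof. exact: (set_mem (valP U)). Qed.

Lemma clopen_part_sub (C : set X) : clopen C -> C !=set0 ->
  exists U, set_val U = C.
Proof.
move=> cC C0; have CP : C \in [set U : set X | clopen U /\ U !=set0].
  exact/mem_set.
by exists (SigSub CP).
Qed.

Lemma clopen_productP z i : set_val i.2 (set_val z i).
Proof. exact: (set_mem (valP z)). Qed.

(** Everything off [U] goes to one chosen point of [U]. As [U] is clopen this is continuous, so any
    family of points of [X] can be corrected continuously into a point of the product. *)
Definition part_retract U (x : X) : X :=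
  if `[< set_val U x >] then x else projT1 (cid (clopen_partP U).2).

Lemma part_retract_in U x : set_val U (part_retract U x).
Proof.
by rewrite /part_retract; case: asboolP => // _; exact: projT2 (cid _).
Qed.

Lemma part_retract_id U x : set_val U x -> part_retract U x = x.
Proof. by rewrite /part_retract; case: asboolP. Qed.

Lemma part_retract_continuous U : continuous (part_retract U).
Proof.
move=> x; have [[oU cU] U0] := clopen_partP U.
have [Ux|nUx] := pselect (set_val U x).
  apply: (eq_on_open_continuous (g := id) oU) => //.
  by move=> y; exact: part_retract_id.
apply: (eq_on_open_continuous (A := ~` set_val U)
  (g := cst (projT1 (cid (clopen_partP U).2)))) => //.
- exact: closed_openC.
- by rewrite /part_retract => y; case: asboolP.
- exact: cst_continuous.
Qed.

Fact to_clopen_product_subproof (f : nat * clopen_part -> X) :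
  (fun i => part_retract i.2 (f i)) \in
  [set z : {ptws (nat * clopen_part) -> X} | forall i, set_val i.2 (z i)].
Proof. by apply/mem_set => i; exact: part_retract_in. Qed.

Definition to_clopen_product (f : nat * clopen_part -> X) : clopen_product :=
  SigSub (to_clopen_product_subproof f).

Lemma to_clopen_productE f i :
  set_val i.2 (f i) -> set_val (to_clopen_product f) i = f i.
Proof. exact: part_retract_id. Qed.

Lemma clopen_product_inj z z' :
  (forall i, set_val z i = set_val z' i) -> z = z'.
Proof. by move=> zz'; apply: val_inj; apply/funext. Qed.

Lemma coord_continuous i : continuous (fun z => set_val z i).
Proof.
move=> z; apply: (@continuous_comp clopen_product _ _ set_val (fun f => f i)).
  exact: set_val_continuous.
exact: (@proj_continuous _ (fun=> X) i).
Qed.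

Lemma continuous_ptws (T : topologicalType) (I : Type)
    (f : T -> {ptws I -> X}) (t : T) :
  (forall j : I, {for t, continuous (fun s => f s j)}) -> {for t, continuous f}.
Proof.
move=> cf; apply/cvg_sup => j U [V [[W oW <-] /= Wft]] /filterS; apply.
by apply: (cf j); exact: open_nbhs_nbhs.
Qed.

Lemma to_clopen_product_continuous (T : topologicalType)
    (f : T -> nat * clopen_part -> X) :
  (forall i, continuous (f^~ i)) -> continuous (to_clopen_product \o f).
Proof.
move=> cf; apply: continuous_comp_initial => t; apply: continuous_ptws => i.
apply: (@continuous_comp _ _ _ (f^~ i) (part_retract i.2)); first exact: cf.
exact: part_retract_continuous.
Qed.

(** Hilbert's hotel in the row of [U]: the new coordinate takes index [(0, U)] and the old ones move
    up by one. The total map [d] stands for the inverse of [e], so that no subtype of [X] is needed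
    for [U]. *)
Lemma clopen_product_absorb (A : topologicalType) (U : clopen_part)
    (e : A -> X) (d : X -> A) : continuous e -> continuous d ->
  (forall a, set_val U (e a)) -> cancel e d ->
  (forall x, set_val U x -> e (d x) = x) ->
  homeomorphic (A * clopen_product)%type clopen_product.
Proof.
move=> ce cd eU eK dK.
pose f (p : A * clopen_product) i : X := if i.2 == U then
  (if i.1 is n.+1 then set_val p.2 (n, U) else e p.1) else set_val p.2 i.
pose g z i : X := if i.2 == U then set_val z (i.1.+1, U) else set_val z i.
have fP p i : set_val i.2 (f p i).
  rewrite /f; case: i => n V /=; case: eqVneq => [->|_]; last first.
    exact: (clopen_productP _ (n, V)).
  by case: n => [|n]; [exact: eU|exact: (clopen_productP _ (n, U))].
have gP z i : set_val i.2 (g z i).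
  rewrite /g; case: i => n V /=; case: eqVneq => [->|_]; last first.
    exact: (clopen_productP _ (n, V)).
  exact: (clopen_productP _ (n.+1, U)).
exists (to_clopen_product \o f),
  (fun z => (d (set_val z (0, U)), to_clopen_product (g z))); split.
- move=> [a z] /=; congr pair.
    by rewrite to_clopen_productE// /f /= eqxx eK.
  apply: clopen_product_inj => -[n V]; rewrite to_clopen_productE// /g /=.
  rewrite !to_clopen_productE// /f /= eqxx.
  by case: eqVneq => [->|].
- move=> z; apply: clopen_product_inj => -[n V] /=.
  rewrite to_clopen_productE// /f /=; case: eqVneq => [->|VU].
    case: n => [|n]; first by rewrite dK//; exact: (clopen_productP z (0, U)).
    by rewrite to_clopen_productE// /g /= eqxx.
  by rewrite to_clopen_productE// /g /= (negPf VU).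
- apply: to_clopen_product_continuous => -[n V] p; rewrite /f /=.
  have c2 i : {for p, continuous (fun q : A * clopen_product => set_val q.2 i)}.
    apply: (@continuous_comp _ _ _ snd (fun z => set_val z i)).
      exact: cvg_snd.
    exact: coord_continuous.
  case: eqVneq => _; last exact: c2.
  case: n => [|n]; last exact: c2.
  by apply: (@continuous_comp _ _ _ fst e); [exact: cvg_fst|exact: ce].
- move=> z; apply: (@cvg_pair _ _ _ (nbhs z) (nbhs (d (set_val z (0, U))))
    (nbhs (to_clopen_product (g z)))).
    apply: (@continuous_comp _ _ _ (fun z => set_val z (0, U)) d).
      exact: coord_continuous.
    exact: cd.
  apply: to_clopen_product_continuous => -[n V]; rewrite /g /=.
  by case: eqVneq => _; exact: coord_continuous.
Qed.

(** * Boxes in Z *)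

Definition cylinder i (C : set X) :=
  [set z : clopen_product | C (set_val z i)].

Lemma cylinder_clopen i (C : set X) : clopen C -> clopen (cylinder i C).
Proof. by move=> cC; apply: preimage_clopen => //; exact: coord_continuous. Qed.

(** The standard basic sets, cut out one cylinder at a time to allow induction; each of them is
    nonempty. *)
Inductive box : set clopen_product -> Prop :=
| box_setT : box setT
| box_cylinder B i C : box B -> clopen C -> B `&` cylinder i C !=set0 ->
    box (B `&` cylinder i C).

Lemma box_clopen B : box B -> clopen B.
Proof.
elim=> [|B' i C _ cB' cC _]; first exact: clopenT.
by apply: clopenI => //; exact: cylinder_clopen.
Qed.

(* The i-th side of a box is again a nonempty clopen set, hence one of the
   factors; [r] lists these factors and is a bijection. *)
Lemma box_permute B : box B ->
  exists r r' : nat * clopen_part -> nat * clopen_part,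
  [/\ cancel r r', cancel r' r,
      forall i, set_val (r i).2 `<=` set_val i.2 &
      B = [set z | forall i, set_val (r i).2 (set_val z i)]].
Proof.
elim=> [|{}B i C _ [r [r' [rK r'K rsub BE]]] cC [z [Bz Cz]]].
  exists id, id; split=> [//|//|i x //|]; apply/seteqP; split=> // z _ i.
  exact: clopen_productP.
have [cU U0] := clopen_partP (r i).2.
have [||D DE] := @clopen_part_sub (set_val (r i).2 `&` C).
- exact: clopenI.
- by exists (set_val z i); split=> //; move: Bz; rewrite BE; exact.
(* Only the side at [i] shrinks, to [D]: [s] sends [r i] to an index of [D] and keeps the factor at
   every other index, so [s \o r] lists the new sides. *)
have [s [s' [sK s'K sD sne]]] := exists_move_to_row (r i) D.
have srsub j : set_val (s (r j)).2 `<=` set_val (r j).2.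
  have [/(can_inj rK) ->|ne] := eqVneq (r j) (r i); last by rewrite sne.
  by rewrite sD DE => x [].
exists (s \o r), (r' \o s'); split=> [j|j|j|] /=.
- by rewrite sK rK.
- by rewrite r'K s'K.
- exact: subset_trans (srsub j) (rsub j).
rewrite BE; apply/seteqP; split=> y /=.
  move=> [By Cy] j; have [ji|ne] := eqVneq (r j) (r i); last by rewrite sne.
  by rewrite ji sD DE (can_inj rK ji); split.
move=> sy; split=> [j|]; first exact: srsub.
by have := sy i; rewrite sD DE => -[].
Qed.

(** The side of [B] at [i] is the factor at index [r i], so relabelling the coordinates along the
    bijection [r] turns the sides into the full list of factors. *)
Lemma box_homeomorphic B : box B -> piece_homeomorphic B [set: clopen_product].
Proof.
move=> /box_permute[r [r' [rK r'K rsub ->]]].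
pose f z i := set_val z (r' i); pose g z i := set_val z (r i).
have gP z i : set_val i.2 (g z i) by apply: rsub; exact: clopen_productP.
have ct (h : nat * clopen_part -> nat * clopen_part) :
    continuous (fun z => to_clopen_product (fun i => set_val z (h i))).
  by apply: to_clopen_product_continuous => i; exact: coord_continuous.
exists (to_clopen_product \o f), (to_clopen_product \o g).
split=> z Bz; split => //; try exact: ct.
- have fP i : set_val i.2 (f z i) by have := Bz (r' i); rewrite r'K.
  apply: clopen_product_inj => i /=.
  by rewrite to_clopen_productE// /g to_clopen_productE// /f rK.
- move=> i /=; rewrite to_clopen_productE//; exact: clopen_productP.
- have fP i : set_val i.2 (f (to_clopen_product (g z)) i).
    by rewrite /f to_clopen_productE// /g r'K; exact: clopen_productP.
  apply: clopen_product_inj => i /=.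
  by rewrite to_clopen_productE// /f to_clopen_productE// /g r'K.
Qed.

(** * Base, separation and compactness of Z *)

Hypothesis X_zdim : zero_dimensional_space X.

Lemma box_base z N : nbhs z N -> exists B, [/\ box B, B z & B `<=` N].
Proof.
(* The topology of the power is a supremum of initial topologies, so convergence of a filter to [z]
   can be checked one coordinate at a time. Asking for a smaller box inside every box around [z]
   makes [F] stable under intersections. *)
pose F : set_system {ptws (nat * clopen_part) -> X} :=
  [set M | forall B, box B -> B z ->
    exists B', [/\ box B', B' z & B' `<=` B `&` set_val @^-1` M]].
have FF : Filter F.
  split=> [B bB Bz|M M' FM FM' B bB Bz|M M' MM' FM B bB Bz].
  - by exists B; split=> // y.
  - have [B' [bB' B'z B'M]] := FM B bB Bz.
    have [D [bD Dz DM']] := FM' B' bB' B'z.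
    exists D; split=> // y /DM' [/B'M [By My] M'y]; split=> //; by split.
  - have [B' [bB' B'z B'M]] := FM B bB Bz.
    by exists B'; split=> // y /B'M [By /MM'].
have Fz : F --> (set_val z : {ptws (nat * clopen_part) -> X}).
  apply/cvg_sup => i M [V [[W oW <-] /= Wz]] VM; apply: filterS VM _.
  move=> B bB Bz; have /zero_dimensional_spaceP zX := X_zdim.
  have [C [cC Cz CW]] := zX _ _ (open_nbhs_nbhs (conj oW Wz)).
  exists (B `&` cylinder i C); split=> //.
    by apply: box_cylinder => //; exists z.
  by move=> y [By Cy]; split=> //; exact: CW.
move=> [V [[W oW <-] /= Wz] WN].
have [B [bB Bz BW]] := Fz _ (open_nbhs_nbhs (conj oW Wz)) _ box_setT I.
by exists B; split=> // y /BW [_ /WN].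
Qed.

Lemma clopen_product_zero_dimensional : zero_dimensional_space clopen_product.
Proof.
apply/zero_dimensional_spaceP => z N /box_base[B [bB Bz BN]].
by exists B; split=> //; exact: box_clopen.
Qed.

Lemma clopen_product_accessible :
  accessible_space X -> accessible_space clopen_product.
Proof.
move=> aX z z' /eqP zz'.
have [i /eqP/aX [A [oA zA z'A]]] : exists i, set_val z i <> set_val z' i.
  by apply/existsNP => h; exact/zz'/clopen_product_inj.
exists (cylinder i A); split.
- by apply: open_comp => // y _; exact: coord_continuous.
- by apply/mem_set; exact: set_mem zA.
- by apply/mem_set; exact: set_mem z'A.
Qed.

Lemma clopen_product_nonempty : [set: clopen_product] !=set0.
Proof.
by exists (to_clopen_product (fun i => projT1 (cid (clopen_partP i.2).2))).
Qed.

(** [to_clopen_product] retracts the whole power of [X] onto Z, and the power is compact by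
    Tychonoff's theorem. *)
Lemma clopen_product_compact :
  compact [set: X] -> compact [set: clopen_product].
Proof.
move=> cX; have -> : [set: clopen_product] =
    (to_clopen_product : {ptws (nat * clopen_part) -> X} -> _) @` setT.
  apply/seteqP; split=> // z _; exists (set_val z) => //.
  apply: clopen_product_inj => i; rewrite to_clopen_productE//.
  exact: clopen_productP.
apply: continuous_compact.
  apply: continuous_subspaceT.
  apply: (@to_clopen_product_continuous {ptws _ -> X} id) => i.
  exact: (@proj_continuous _ (fun=> X) i).
have := @tychonoff _ (fun _ : nat * clopen_part => X) _ (fun=> cX).
by congr compact; apply/seteqP; split.
Qed.

End clopen_product.

(** * Decomposition method for a countable sum of copies *)

Lemma clopen_slice0 (T : topologicalType) (C : set T) :
  clopen C -> clopen ([set 0] `*` C : set (nat * T)).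
Proof.
move=> cC; have -> : [set 0] `*` C =
  (fst @^-1` [set 0] `&` snd @^-1` C : set (nat * T)) by [].
apply: clopenI; apply: preimage_clopen => //; last 2 first.
- by move=> ?; exact: cvg_fst.
- by move=> ?; exact: cvg_snd.
- by split; [exact: discrete_open|exact: discrete_closed].
Qed.

(* Shifting the copies of [C] up by one frees the lowest one. *)
Lemma remove_slice0_homeomorphic (T : topologicalType) (C : set T) :
  clopen C ->
  piece_homeomorphic (~` ([set 0] `*` C)) [set: (nat * T)%type].
Proof.
move=> [oC cC].
have cif (f : nat -> nat) : continuous
    (fun p : nat * T => if `[< C p.2 >] then (f p.1, p.2) else p).
  move=> p; have cf : {for p, continuous (fun q : nat * T => (f q.1, q.2))}.
    apply: (@cvg_pair _ _ _ (nbhs p) (nbhs (f p.1)) (nbhs p.2)).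
      2: exact: cvg_snd.
    apply: (@continuous_comp _ _ _ fst f); first exact: cvg_fst.
    by move=> U /nbhs_singleton Uf; apply: filterS (discrete_set1 _) => _ ->.
  have [Cp|nCp] := pselect (C p.2).
    apply: (@eq_on_open_continuous _ _ _ _ (snd @^-1` C));
      [|exact: Cp| |exact: cf].
      by apply: open_comp => // ? _; exact: cvg_snd.
    by move=> q Cq; case: asboolP.
  apply: (@eq_on_open_continuous _ _ _ id (snd @^-1` (~` C)));
    [|exact: nCp| |by []].
    by apply: open_comp (closed_openC cC) => // ? _; exact: cvg_snd.
  by move=> q Cq; case: asboolP.
(* The truncated predecessor of 0 does no harm: over [C], level 0 has been removed from the
   domain. *)
exists (fun p => if `[< C p.2 >] then (p.1.-1, p.2) else p),
  (fun p => if `[< C p.2 >] then (p.1.+1, p.2) else p).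
split=> -[n t] h; split=> //; try exact: cif.
- rewrite /=; have [Ct|nCt] := pselect (C t); last by rewrite !asboolF.
  by rewrite !asboolT//; case: n h => // -[].
- rewrite /=; have [Ct|nCt] := pselect (C t); first by rewrite asboolT// => -[].
  by rewrite asboolF// => -[].
- by rewrite /=; have [Ct|nCt] := pselect (C t);
    [rewrite !asboolT|rewrite !asboolF].
Qed.

(* Pelczynski's decomposition: from [T = nat * T] one gets [T = T + C], and
   [C] containing a copy of [T] gives [C = T + C]. *)
Lemma clopen_piece_absorb (T : topologicalType) (B C : set T) :
  homeomorphic (nat * T)%type T -> clopen B -> clopen C -> B `<=` C ->
  piece_homeomorphic B [set: T] -> piece_homeomorphic C [set: T].
Proof.
move=> /homeomorphic_piece NT cB cC BC BT.
have BN := piece_homeomorphic_trans BT (piece_homeomorphic_sym NT).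
have [f [g [fB gN]]] := BN.
pose L : set (nat * T) := [set 0] `*` setT.
have cL : clopen L by apply: clopen_slice0; exact: clopenT.
have cf y : B y -> {for y, continuous f} by case/fB.
have rB A : piece_homeomorphic A (B `&` f @^-1` A).
  have := piece_homeomorphic_restrict A gN fB.
  by rewrite setTI.
(* Under [f], which identifies [B] with [nat * T], [B0] is the lowest slice and [B1] the union of
   all others. *)
pose E := C `&` ~` B; pose B0 := B `&` f @^-1` L.
pose B1 := B `&` f @^-1` (~` L).
have cE : clopen E by apply: clopenI => //; exact: clopenC.
have cB0 : clopen B0 by exact: clopen_setI_preimage.
have cB1 : clopen B1.
  by apply: clopen_setI_preimage => //; exact: clopenC.
have B1B : piece_homeomorphic B1 B.
  apply: piece_homeomorphic_trans (piece_homeomorphic_sym (rB _)) _.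
  apply: piece_homeomorphic_trans (piece_homeomorphic_sym BN).
  by apply: remove_slice0_homeomorphic; exact: clopenT.
have BE0 : B `&` E = set0 by apply/seteqP; split=> // x [Bx []].
(* Since [B1] is a copy of [B], taking [B0] away from [C] does not change its type. *)
have C'C : piece_homeomorphic (B1 `|` E) C.
  have -> : C = B `|` E.
    rewrite /E; apply/seteqP; split=> x.
      by move=> Cx; have [|] := pselect (B x); [left|right].
    by move=> [/BC|[]].
  apply: piece_homeomorphic_setU B1B _; [exact: cB1.1|exact: cE.1|exact: cB.1
    |exact: cE.1| |exact: BE0|].
    by apply/seteqP; split=> // x [[Bx _] [_ /(_ Bx)]].
  by exists id, id; split=> x Ex; split.
have CB : C = B0 `|` (B1 `|` E).
  rewrite /B0 /B1 /E; apply/seteqP; split=> x.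
    move=> Cx; have [Bx|nBx] := pselect (B x); last by right; right.
    by have [|] := pselect (L (f x)); [left|right; left].
  by move=> [[/BC]|[[/BC]|[]]].
(* Both sides are cut in two. The complement of the slice of [C] is [nat * T] again, hence [T],
   hence [B0]; the slice of [C] matches the rest [B1 | E] of [C]. *)
have NC : piece_homeomorphic [set: (nat * T)%type] C.
  have cC0 : clopen ([set 0] `*` C : set (nat * T)) by exact: clopen_slice0.
  rewrite {1}CB -(setvU ([set 0] `*` C)).
  apply: piece_homeomorphic_setU => //.
  - by case: (clopenC set0 cC0).
  - by case: cC0.
  - by case: cB0.
  - by case: (clopenU cB1 cE).
  - by rewrite setICl.
  - apply/seteqP; split=> // x [[Bx Lx]] [[_ /(_ Lx)//]|[_ /(_ Bx)//]].
  - apply: piece_homeomorphic_trans (remove_slice0_homeomorphic cC) _.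
    apply: piece_homeomorphic_trans NT _.
    apply: piece_homeomorphic_trans (rB L).
    exact/piece_homeomorphic_sym/piece_homeomorphic_slice.
  - apply: piece_homeomorphic_trans (piece_homeomorphic_slice _ _) _.
    exact: piece_homeomorphic_sym.
exact: piece_homeomorphic_trans (piece_homeomorphic_sym NC) NT.
Qed.

(** * Compact case: finite disjoint unions of boxes *)

Inductive box_union (X : topologicalType) : set (clopen_product X) -> Prop :=
| box_union0 : box_union set0
| box_union_box B : box B -> box_union B
| box_unionU A B : box_union A -> box_union B -> A `&` B = set0 ->
    box_union (A `|` B).

Section box_union.
Context (X : topologicalType).
Implicit Types A B S : set (clopen_product X).

(** This property passes easily to complements, intersections and unions; applied to the box [setT]
    it shows that [S] itself is a box union. *)
Definition box_splitting S := forall B, box B ->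
  box_union (B `&` S) /\ box_union (B `\` S).

Lemma box_union_splitting A S : box_splitting S -> box_union A ->
  box_union (A `&` S) /\ box_union (A `\` S).
Proof.
move=> sS; elim=> [|B bB|{}A B _ [IA DA] _ [IB DB] AB0].
- by rewrite set0I set0D; split; exact: box_union0.
- exact: sS.
- rewrite setIUl setDUl; split; apply: box_unionU => //;
    apply/seteqP; split=> //.
    by move=> x [[Ax _] [Bx _]]; rewrite -AB0.
  by move=> x [[Ax _] [Bx _]]; rewrite -AB0.
Qed.

Lemma box_splittingC S : box_splitting S -> box_splitting (~` S).
Proof.
by move=> sS B /sS [? ?]; rewrite -setDE; split=> //; rewrite setDE setCK.
Qed.

Lemma box_splittingI S S' :
  box_splitting S -> box_splitting S' -> box_splitting (S `&` S').
Proof.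
move=> sS sS' B bB; have [bI bD] := sS B bB.
have [bII bID] := box_union_splitting sS' bI.
rewrite setIA; split=> //.
(* Cutting by [S] first, and only the part inside [S] by [S'], keeps the pieces disjoint. *)
have -> : B `\` (S `&` S') = (B `\` S) `|` ((B `&` S) `\` S').
  apply/seteqP; split=> x /=.
    move=> [Bx nSS']; have [Sx|nSx] := pselect (S x); last by left.
    by right; split=> // S'x; exact: nSS'.
  by move=> [[Bx nS]|[[Bx Sx] nS']]; split=> // -[].
by apply: box_unionU => //; apply/seteqP; split=> // x [[_ nS] [[_ /nS]]].
Qed.

Lemma box_splittingU S S' :
  box_splitting S -> box_splitting S' -> box_splitting (S `|` S').
Proof.
move=> sS sS'; rewrite -[S `|` S']setCK setCU.
by apply/box_splittingC/box_splittingI; exact: box_splittingC.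
Qed.

(** The complement of a cylinder is the cylinder over the complement of [C], so each part of a box
    is a box or empty. *)
Lemma cylinder_splitting i (C : set X) :
  clopen C -> box_splitting (cylinder i C).
Proof.
move=> cC B bB.
have bu D : clopen D -> box_union (B `&` cylinder i D).
  move=> cD; have [->|/set0P ne] := eqVneq (B `&` cylinder i D) set0.
    exact: box_union0.
  by apply: box_union_box; exact: box_cylinder.
by split; [exact: bu|apply: (bu (~` C)); exact: clopenC].
Qed.

Lemma box_splitting_box B : box B -> box_splitting B.
Proof.
elim=> [D bD|{}B i C _ IH cC _].
  by rewrite setIT setDT; split; [exact: box_union_box|exact: box_union0].
by apply: box_splittingI => //; exact: cylinder_splitting.
Qed.

(** Compactness enters through a cluster point. If [C] were not splitting, removing splitting
    subsets from [C] would always leave a point, giving a proper filter; but a box inside [C] around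
    a cluster point is itself such a subset. *)
Lemma clopen_box_union (C : set (clopen_product X)) :
  zero_dimensional_space X -> compact [set: clopen_product X] ->
  clopen C -> box_union C.
Proof.
move=> zX cZ [oC cC].
suff sC : box_splitting C by have := (sC _ (box_setT X)).1; rewrite setTI.
apply: contrapT => nsC.
pose D := [set S | box_splitting S /\ S `<=` C].
have D0 : D set0.
  by split=> // B bB; rewrite setI0 setD0; split;
    [exact: box_union0|exact: box_union_box].
pose F := filter_from D (fun S => C `\` S).
have FF : ProperFilter F.
  apply: filter_from_proper.
    apply: filter_from_filter; first by exists set0.
    move=> S S' [sS SC] [sS' S'C]; exists (S `|` S'); last by rewrite setDUr.
    by split; [exact: box_splittingU|move=> x [/SC|/S'C]].
  move=> S [sS SC]; apply/set0P/eqP => CS; apply: nsC.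
  suff -> : C = S by [].
  by apply/seteqP; split=> // x Cx; apply: contrapT => nSx;
    have : (C `\` S) x by []; rewrite CS.
have FC : F C by exists set0 => // x [].
have [z [Cz zF]] := subclosed_compact cC cZ (@subsetT _ C) FF FC.
have [B [bB Bz BC]] := box_base zX (open_nbhs_nbhs (conj oC Cz)).
have FB : F (C `\` B) by exists B => //; split=> //; exact: box_splitting_box.
have nB : nbhs z B by apply: open_nbhs_nbhs; split=> //; case: (box_clopen bB).
by have [y [[_ nBy] By]] := zF _ _ FB nB.
Qed.

Lemma box_union_open A : box_union A -> open A.
Proof.
elim=> [|B bB|{}A B _ oA _ oB _]; first exact: open0.
- by case: (box_clopen bB).
- exact: openU.
Qed.

(** Two disjoint nonempty parts are copies of Z by induction, and together they form [bool * Z],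
    which is Z again; an empty part is simply dropped. *)
Lemma box_union_homeomorphic A :
  homeomorphic (bool * clopen_product X)%type (clopen_product X) ->
  box_union A -> A !=set0 -> piece_homeomorphic A [set: clopen_product X].
Proof.
move=> /homeomorphic_piece h; elim=> [[]//|B bB _|{}A B bA IA bB IB AB0].
  exact: box_homeomorphic.
have [->|/set0P/IA hA] := eqVneq A set0; first by rewrite set0U.
have [->|/set0P/IB hB _] := eqVneq B set0; first by rewrite setU0.
apply: piece_homeomorphic_trans h.
have ob b : open ([set b] `*` setT : set (bool * clopen_product X)).
  have -> : [set b] `*` setT =
    (fst @^-1` [set b] : set (bool * clopen_product X)).
    by apply/seteqP; split=> // x [].
  by apply: open_comp; [move=> ? _; exact: cvg_fst|exact: discrete_open].
have -> : [set: (bool * clopen_product X)%type] =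
    [set true] `*` setT `|` [set false] `*` setT.
  by apply/seteqP; split=> // -[[] z] _; [left|right].
apply: piece_homeomorphic_setU => //; try exact: box_union_open.
- by apply/seteqP; split=> // -[b z] [[/= -> _] []].
- apply: piece_homeomorphic_trans hA _.
  exact/piece_homeomorphic_sym/piece_homeomorphic_slice.
- apply: piece_homeomorphic_trans hB _.
  exact/piece_homeomorphic_sym/piece_homeomorphic_slice.
Qed.

End box_union.

(** * Products with a discrete space *)

Lemma prod_zero_dimensional (X : topologicalType)
    (K : discreteTopologicalType) :
  zero_dimensional_space X -> zero_dimensional_space (X * K)%type.
Proof.
move=> /zero_dimensional_spaceP zX; apply/zero_dimensional_spaceP.
move=> [x k] N [[P Q] [/= Px Qk] PQN].
have [C [cC Cx CP]] := zX x P Px; exists (fst @^-1` C `&` snd @^-1` [set k]).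
split=> //.
  apply: clopenI; apply: preimage_clopen => //.
  - by move=> ?; exact: cvg_fst.
  - by split; [exact: discrete_open|exact: discrete_closed].
  - by move=> ?; exact: cvg_snd.
move=> [y l] [/= Cy ->]; apply: PQN; split; first exact: CP.
exact: nbhs_singleton Qk.
Qed.

Lemma prod_accessible (X : topologicalType) (K : discreteTopologicalType) :
  accessible_space X -> accessible_space (X * K)%type.
Proof.
move=> aX [x k] [y l] ne.
have [xy|/aX[A [oA /set_mem xA /set_mem yA]]] := eqVneq x y.
  exists (snd @^-1` [set k]); split; last 2 first.
  - exact/mem_set.
  - by apply/mem_set => /= lk; move: ne; rewrite xy lk eqxx.
  by apply: open_comp; [move=> ? _; exact: cvg_snd|exact: discrete_open].
exists (fst @^-1` A); split; [|exact/mem_set|exact/mem_set].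
by apply: open_comp => // ? _; exact: cvg_fst.
Qed.

(** * Absorption of the factors X and K *)

Section factor.
Context (X : topologicalType) (K : discreteTopologicalType) (k0 : K).
Hypothesis X_neq0 : [set: X] !=set0.

Let Z := clopen_product (X * K)%type.

(** [X] is homeomorphic to its slice at [k0], which is clopen in [X * K] and therefore one of the
    factors of [Z]. *)
Lemma clopen_product_factorl : homeomorphic (X * Z)%type Z.
Proof.
have [||U UE] := @clopen_part_sub (X * K)%type (snd @^-1` [set k0]).
- apply: preimage_clopen; last by move=> ?; exact: cvg_snd.
  by split; [exact: discrete_open|exact: discrete_closed].
- by have [x _] := X_neq0; exists (x, k0).
apply: (@clopen_product_absorb _ _ U (fun x => (x, k0)) fst); rewrite ?UE //.
- by move=> x; apply: cvg_pair => //; exact: cvg_cst.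
- by move=> ?; exact: cvg_fst.
- by move=> [x k] /= ->.
Qed.

(** A copy of [K] over a point of [X] need not be clopen, so [K] is absorbed together with [X]:
    [K * Z] is [K * (X * Z)], that is [(X * K) * Z], and [X * K] is a clopen part of itself. *)
Lemma clopen_product_factorr : homeomorphic (K * Z)%type Z.
Proof.
have [f [g [fK gK cf cg]]] := clopen_product_factorl.
have [||U UE] := @clopen_part_sub (X * K)%type setT.
- exact: clopenT.
- by have [x _] := X_neq0; exists (x, k0).
have [f' [g' [fK' gK' cf' cg']]] : homeomorphic ((X * K) * Z)%type Z.
  apply: (@clopen_product_absorb _ _ U id id); rewrite ?UE //; by move=> ? ?.
exists (fun p => f' (((g p.2).1, p.1), (g p.2).2)),
  (fun z => let p := g' z in (p.1.2, f (p.1.1, p.2))); split.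
- by move=> [k z] /=; rewrite fK' /= -surjective_pairing gK.
- by move=> z /=; rewrite fK -!surjective_pairing gK'.
- move=> p; apply: continuous_comp; last exact: cf'.
  have cg2 : {for p, continuous (fun q : K * Z => g q.2)}.
    by apply: continuous_comp; [exact: cvg_snd|exact: cg].
  have c1 : {for p, continuous (fun q : K * Z => (g q.2).1)}.
    by apply: continuous_comp cg2 _; exact: cvg_fst.
  have c2 : {for p, continuous (fun q : K * Z => (g q.2).2)}.
    by apply: continuous_comp cg2 _; exact: cvg_snd.
  have c3 : {for p, continuous (fun q : K * Z => q.1)} by exact: cvg_fst.
  exact: cvg_pair (cvg_pair c1 c3) c2.
- move=> z.
  have c1 : {for z, continuous (fun w : Z => (g' w).1)}.
    by apply: continuous_comp; [exact: cg'|exact: cvg_fst].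
  have c11 : {for z, continuous (fun w : Z => (g' w).1.1)}.
    by apply: continuous_comp c1 _; exact: cvg_fst.
  have c12 : {for z, continuous (fun w : Z => (g' w).1.2)}.
    by apply: continuous_comp c1 _; exact: cvg_snd.
  have c2 : {for z, continuous (fun w : Z => (g' w).2)}.
    by apply: continuous_comp; [exact: cg'|exact: cvg_snd].
  have c3 : {for z, continuous (fun w : Z => f ((g' w).1.1, (g' w).2))}.
    apply: (@continuous_comp _ _ _ (fun w : Z => ((g' w).1.1, (g' w).2)) f).
      exact: cvg_pair c11 c2.
    exact: cf.
  exact: cvg_pair c12 c3.
Qed.

End factor.

Theorem corollary16 (X : topologicalType) (X_tych : tychonoff_space X)
    (X_neq0 : [set: X] !=set0) (X_zdim : zero_dimensional_space X) :
  (exists Y : topologicalType,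
    [/\ tychonoff_space Y, [set: Y] !=set0, zero_dimensional_space Y
      & h_homogeneous (X * Y)%type]) /\
  (compact [set: X] ->
   exists Y : topologicalType,
    [/\ tychonoff_space Y, [set: Y] !=set0, zero_dimensional_space Y,
        compact [set: Y] & h_homogeneous (X * Y)%type]).
Proof.
have aX := X_tych.1.
have zXK (K : discreteTopologicalType) := prod_zero_dimensional K X_zdim.
have tZ (K : discreteTopologicalType) :
    tychonoff_space (clopen_product (X * K)%type).
  split; first exact/clopen_product_accessible/prod_accessible.
  exact/zero_dimensional_completely_regular/clopen_product_zero_dimensional.
split=> [|cX].
  exists (clopen_product (X * nat)%type); split.
  - exact: tZ.
  - exact: clopen_product_nonempty.
  - exact: clopen_product_zero_dimensional (zXK _).
  (* It remains to compare the clopen sets of Z with Z; any box around a point of [C] inside [C] is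
     the copy of Z to start from. *)
  apply: homeomorphic_h_homogeneous (clopen_product_factorl 0 X_neq0) _.
  move=> C cC [z Cz].
  have [B [bB _ BC]] := box_base (zXK _) (open_nbhs_nbhs (conj cC.1 Cz)).
  apply: clopen_piece_absorb (box_clopen bB) cC BC (box_homeomorphic bB).
  exact: (clopen_product_factorr 0).
have cZ : compact [set: clopen_product (X * bool)%type].
  apply: clopen_product_compact; rewrite -setXTT.
  exact: compact_setX cX bool_compact.
exists (clopen_product (X * bool)%type); split=> //.
- exact: tZ.
- exact: clopen_product_nonempty.
- exact: clopen_product_zero_dimensional (zXK _).
(* The same reduction; here compactness makes [C] itself a box union. *)
apply: homeomorphic_h_homogeneous (clopen_product_factorl true X_neq0) _.
move=> C cC; apply: box_union_homeomorphic.
  exact: (clopen_product_factorr true).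
exact: clopen_box_union (zXK _) cZ cC.
Qed.
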